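(* Let $T$ be a tree and let $\eta(T)$ be the number of $\alpha_3$-critical edges of $T$. Then (1) every maximum dissociation set of $T$ contains exactly one end-vertex of each insulated $\alpha_3$-critical edge; (2) every maximum dissociation set of $T$ contains exactly two vertices of each critical $3$-path; (3) $\alpha_3(T)=|\mathcal{A}_T|+\eta(T)$.
   Context: A dissociation set of a graph $G$ is a set $S$ of vertices such that $G[S]$ has maximum degree at most $1$; a maximum dissociation set is one of maximum cardinality, which is denoted $\alpha_3(G)$. An edge $e$ is $\alpha_3$-critical if $\alpha_3(G-e)>\alpha_3(G)$, where $G-e$ is obtained by deleting $e$. An $\alpha_3$-critical edge is insulated if it shares no end-vertex with any other $\alpha_3$-critical edge. A critical $3$-path is a subgraph isomorphic to the path on $3$ vertices both of whose edges are $\alpha_3$-critical. $\mathcal{A}_T$ denotes the set of vertices of $T$ that belong to every maximum dissociation set of $T$. *)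

(* Defs.v *)
From mathcomp Require Import all_boot.

Set Implicit Arguments.
Unset Strict Implicit.
Unset Printing Implicit Defensive.

(* Finite simple graphs are given by their adjacency relation [e : rel V] on a
   [finType V]; [simple_graph e] says that [e] is such a relation.  Edges are
   the two-element sets of adjacent vertices. *)

Section Graphs.

Variables (V : finType) (e : rel V).

Definition simple_graph : Prop := symmetric e /\ irreflexive e.

Definition connected_graph : Prop :=
  0 < #|V| /\ forall x y : V, connect e x y.

(* [ucycle e c]: the entries of [c] are distinct and cyclically adjacent; cycles
   have length at least 3, since a single edge [x y] gives [ucycle e [:: x; y]]. *)
Definition acyclic : Prop := forall c : seq V, 2 < size c -> ~ ucycle e c.

Definition tree : Prop := [/\ simple_graph, connected_graph & acyclic].

Definition edges : {set {set V}} :=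
  [set [set p.1; p.2] | p : V * V & e p.1 p.2].

Definition del_edge (f : {set V}) : rel V :=
  fun x y => e x y && ([set x; y] != f).

Definition induced_degree (S : {set V}) (x : V) : nat := #|[set y in S | e x y]|.

Definition dissociation_set (S : {set V}) : bool :=
  \max_(x in S) induced_degree S x <= 1.

Definition alpha3 : nat := \max_(S : {set V} | dissociation_set S) #|S|.

Definition max_dissociation_set (S : {set V}) : bool :=
  dissociation_set S && (#|S| == alpha3).

End Graphs.

Section Critical.

Variables (V : finType) (e : rel V).

Definition critical_edges : {set {set V}} :=
  [set f in edges e | alpha3 e < alpha3 (del_edge e f)].

Definition eta : nat := #|critical_edges|.

Definition insulated (f : {set V}) : Prop :=
  f \in critical_edges /\
  forall g : {set V}, g \in critical_edges -> g != f -> [disjoint f & g].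

(* The subgraph with vertices [u], [v], [w] and edges [uv], [vw]. *)
Definition critical_3path (u v w : V) : Prop :=
  [/\ uniq [:: u; v; w], [set u; v] \in critical_edges
    & [set v; w] \in critical_edges].

Definition core : {set V} :=
  [set v | [forall S : {set V}, max_dissociation_set e S ==> (v \in S)]].

End Critical.

(* Main.v *)
(* Replacing a dissociation set [S] by another one [D] on a component [B] of [T - x]
   can only create a conflict at the edge joining [x] to [B].  If [x] lies in a maximum
   set [S] and [D] is a dissociation set avoiding [x] with [#|S| <= #|D|], then some
   component gains under this swap, and the edge from [x] to it is critical.  Hence the
   vertices of [S] outside the core are exactly those incident with critical edges.
   Likewise, a dissociation set missing both ends of a critical edge can be enlarged by
   a swap on one side.  So every maximum set meets each critical edge, and if it contains
   the middle vertex of a critical 3-path it contains exactly one of the other two;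
   critical edges do not form paths on 4 vertices.  This makes the incidence between
   [S] minus the core and the critical edges, suitably restricted, a bijection. *)
Require Import Defs.
From mathcomp Require Import all_boot.

Set Implicit Arguments.
Unset Strict Implicit.
Unset Printing Implicit Defensive.

(** * Dissociation sets and their swaps on a vertex set *)

Section Dissociation.

Variables (V : finType) (e : rel V).
Implicit Types (S D B f : {set V}) (x y u v w : V).

Lemma dissociationP S :
  reflect (forall x y z, x \in S -> y \in S -> z \in S -> e x y -> e x z -> y = z)
          (dissociation_set e S).
Proof.
apply: (iffP (bigmax_leqP _ _ _)) => [dS x y z xS yS zS exy exz | dS x xS].
  by apply: (card_le1_eqP (dS x xS)); rewrite inE ?yS ?zS.
apply/card_le1_eqP => y z; rewrite !inE => /andP[yS exy] /andP[zS exz].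
exact: (dS x).
Qed.

Lemma dissociation_set0 : dissociation_set e set0.
Proof. by apply/dissociationP => x y z; rewrite inE. Qed.

Lemma dissociation_sub S D :
  S \subset D -> dissociation_set e D -> dissociation_set e S.
Proof.
move=> /subsetP SD /dissociationP dD; apply/dissociationP => x y z *.
by apply: (dD x); rewrite ?SD.
Qed.

Lemma dissociation_leq S : dissociation_set e S -> #|S| <= alpha3 e.
Proof. exact: (@leq_bigmax_cond _ (dissociation_set e) (fun S => #|S|)). Qed.

Lemma max_dissociation_exists : exists S, max_dissociation_set e S.
Proof.
have [|S dS aS] := @eq_bigmax_cond _ (dissociation_set e) (fun S => #|S|).
  by apply/card_gt0P; exists set0; exact: dissociation_set0.
by exists S; apply/andP; split; [exact: dS | rewrite -aS].
Qed.

Definition swap S D B := (S :\: B) :|: (D :&: B).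

Lemma in_swap S D B x : (x \in swap S D B) = if x \in B then x \in D else x \in S.
Proof. by rewrite !inE; case: (x \in B); rewrite ?andbT ?andbF ?orbF. Qed.

Lemma swapI S D B : swap S D B :&: B = D :&: B.
Proof. by apply/setP => x; rewrite inE in_swap inE; case: (x \in B); rewrite ?andbF. Qed.

Lemma swapD S D B : swap S D B :\: B = S :\: B.
Proof. by apply/setP => x; rewrite inE in_swap inE; case: (x \in B). Qed.

Lemma card_swap S D B : #|swap S D B| = #|D :&: B| + #|S :\: B|.
Proof. by rewrite -(cardsID B) swapI swapD. Qed.

Lemma swap_ltn S D B : #|S :&: B| < #|D :&: B| -> #|S| < #|swap S D B|.
Proof. by rewrite card_swap -(cardsID B S) ltn_add2r. Qed.

End Dissociation.

(** * Swaps across cuts, and the branches at a vertex *)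

Section Swap.

Variables (V : finType) (e : rel V).
Hypothesis (e_sym : symmetric e).
Implicit Types (S D B f : {set V}) (x y u v w : V).

(** No edge crosses the boundary of [B], so each constraint involves only [S] or only [D]. *)
Lemma swap_dissociation S D B :
    dissociation_set e S -> dissociation_set e D ->
    (forall y z, y \in B -> z \notin B -> ~~ e y z) ->
  dissociation_set e (swap S D B).
Proof.
move=> /dissociationP dS /dissociationP dD cut.
have same y z : e y z -> (y \in B) = (z \in B).
  move=> eyz; case: (boolP (y \in B)) (boolP (z \in B)) => yB [] zB //.
    by move: (cut _ _ yB zB); rewrite eyz.
  by move: (cut _ _ zB yB); rewrite e_sym eyz.
apply/dissociationP => x y z; rewrite !in_swap => + + + exy exz.
rewrite -(same _ _ exy) -(same _ _ exz).
by case: ifP => _ *; [apply: (dD x) | apply: (dS x)].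
Qed.

Lemma del_edge_sym f : symmetric (del_edge e f).
Proof. by move=> x y; rewrite /del_edge e_sym setUC. Qed.

Lemma dissociation_del f S :
  dissociation_set e S -> dissociation_set (del_edge e f) S.
Proof.
move=> /dissociationP dS; apply/dissociationP => x y z xS yS zS.
by move=> /andP[exy _] /andP[exz _]; apply: (dS x).
Qed.

(** [S] misses a vertex of [f], so [f] is no edge of the induced graph and deleting it changes
    nothing there. *)
Lemma dissociation_of_del f S :
  ~~ (f \subset S) -> dissociation_set (del_edge e f) S -> dissociation_set e S.
Proof.
move=> fS /dissociationP dS; apply/dissociationP => x y z xS yS zS exy exz.
have keep t : t \in S -> e x t -> del_edge e f x t.
  move=> tS ext; rewrite /del_edge ext; apply: contraNN fS => /eqP <-.
  by rewrite subUset !sub1set xS tS.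
by apply: (dS x); rewrite ?keep.
Qed.

(* The component of [r] in the graph minus the vertex [x] (only [{x}] if [r = x]). *)
Definition off x : rel V := fun a b => [&& e a b, a != x & b != x].
Definition branch x r : {set V} := [set y | connect (off x) r y].

Lemma off_sym x : connect_sym (off x).
Proof. by apply: sym_connect_sym => a b; rewrite /off e_sym; congr (_ && _); rewrite andbC. Qed.

Lemma branch_self x r : r \in branch x r.
Proof. by rewrite inE connect0. Qed.

Lemma branch_eq x r u : u \in branch x r -> branch x u = branch x r.
Proof.
rewrite inE => ru; apply/setP => y; rewrite !inE.
by rewrite (same_connect (off_sym x) ru).
Qed.

Lemma branch_center x r : r != x -> x \notin branch x r.
Proof.
move=> rx; rewrite inE off_sym; apply/negP => /connectP[[|a p] /=].
  by move=> _ rE; rewrite rE eqxx in rx.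
by rewrite /off eqxx andbF.
Qed.

Lemma branch_center_self x : branch x x = [set x].
Proof.
apply/setP => y; rewrite !inE; apply/idP/eqP => [|->]; last exact: connect0.
by case/connectP => [[|a p]] //=; rewrite /off eqxx andbF.
Qed.

Lemma branch_exit x r y z :
  r != x -> y \in branch x r -> z \notin branch x r -> e y z -> z = x.
Proof.
move=> rx yB zB eyz; apply/eqP; apply: contraNT zB => zx.
rewrite -(branch_eq yB) inE; apply: connect1; rewrite /off eyz zx andbT.
by apply: contraTneq yB => ->; exact: branch_center.
Qed.

(** The branches partition the vertices other than [x]; if none gained, summing over them would
    contradict the inequality. *)
Lemma branch_heavy x S D :
    x \notin D -> #|S :\ x| < #|D| ->
  exists2 r, r != x & #|S :&: branch x r| < #|D :&: branch x r|.
Proof.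
move=> xD lt.
have [/existsP[r lt_r] | /existsPn ge] :=
  boolP [exists r, #|(S :\ x) :&: branch x r| < #|D :&: branch x r|].
  have rx : r != x.
    apply: contraTneq lt_r => ->; rewrite -leqNgt branch_center_self.
    suff -> : D :&: [set x] = set0 by rewrite cards0.
    by apply/eqP; rewrite setIC setI_eq0 disjoints1.
  exists r => //; congr (_ < _): lt_r; apply: eq_card => y.
  rewrite !inE; case: eqP => [->|//].
  by have /negbTE := branch_center rx; rewrite inE => ->; rewrite !andbF.
suff : #|D| <= #|S :\ x| by rewrite leqNgt lt.
have split_card (A : {set V}) : #|A| = \sum_r #|[set y in A | root (off x) y == r]|.
  rewrite -sum1_card (partition_big (root (off x)) predT) //=.
  by apply: eq_bigr => r _; rewrite sum1dep_card.
rewrite (split_card D) (split_card (S :\ x)); apply: leq_sum => r _.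
have [rr | nr] := eqVneq (root (off x) r) r.
  have cls (A : {set V}) : [set y in A | root (off x) y == r] = A :&: branch x r.
    apply/setP => y; by rewrite !inE -(root_connect (off_sym x)) rr eq_sym.
  by rewrite !cls leqNgt ge.
(* An [r] that is not the root of its class labels an empty class. *)
rewrite (_ : [set y in D | _] = set0) ?cards0 //.
apply/setP => y; rewrite !inE; apply/negbTE; apply/negP => /andP[_ /eqP yr].
by case/eqP: nr; rewrite -yr (root_root (off_sym x)).
Qed.

End Swap.

(** * Critical edges of forests *)

Section Forest.

Variables (V : finType) (e : rel V).
Hypotheses (e_sym : symmetric e) (e_irr : irreflexive e) (e_acyclic : acyclic e).
Implicit Types (S D B f : {set V}) (x y u v w : V).

Lemma edge_neq x y : e x y -> x != y.
Proof. by apply: contraTneq => ->; rewrite e_irr. Qed.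

Lemma off_path x u p : path (off e x) u p -> path e u p && (x \notin p).
Proof.
elim: p u => //= a p IH u /andP[/and3P[-> _ ax] /IH/andP[-> xp]].
by rewrite inE eq_sym (negbTE ax).
Qed.

(** A second neighbour of [x] in the branch would close a cycle through [x] and a simple path from
    [u]. *)
Lemma branch_edge x u y : e x u -> y \in branch e x u -> e x y -> y = u.
Proof.
move=> exu; rewrite inE => /connectP[p0 /shortenP[p pth unq _] ->] exl.
case: p pth unq exl => [//|a p] /off_path/andP[pth xp] unq exl.
case: (e_acyclic (c := [:: x, u, a & p])) => //.
rewrite /ucycle /= exu rcons_path -/(path e a p).
have /= /andP[-> ->] := pth; rewrite e_sym exl /=.
by rewrite inE (negbTE (edge_neq exu)) xp.
Qed.

Lemma branch_exit_edge x u y z :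
  e x u -> y \in branch e x u -> z \notin branch e x u -> e y z -> y = u /\ z = x.
Proof.
move=> exu yB zB eyz.
have ux : u != x by rewrite eq_sym edge_neq.
have zx := branch_exit e_sym ux yB zB eyz; split=> //.
by apply: branch_edge exu yB _; rewrite e_sym -zx.
Qed.

(** In a forest the only edge leaving the branch is the deleted one, so no remaining edge
    crosses. *)
Lemma swap_branch_del x u S D :
    e x u -> dissociation_set (del_edge e [set x; u]) S ->
    dissociation_set (del_edge e [set x; u]) D ->
  dissociation_set (del_edge e [set x; u]) (swap S D (branch e x u)).
Proof.
move=> exu dS dD; apply: swap_dissociation => //; first exact: del_edge_sym.
move=> y z yB zB; apply/negP => /andP[eyz /eqP]; apply.
by have [-> ->] := branch_exit_edge exu yB zB eyz; rewrite setUC.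
Qed.

Lemma criticalP u v :
  reflect (e u v /\ exists2 D, dissociation_set (del_edge e [set u; v]) D
                             & alpha3 e < #|D|)
          ([set u; v] \in critical_edges e).
Proof.
rewrite inE; apply: (iffP andP) => [[uvE lt]|[euv [D dD lt]]]; split.
- case/imsetP: uvE => -[a b] /=; rewrite inE /= => eab /setP uvab.
  have := uvab u; have := uvab v; have := uvab a; have := uvab b.
  rewrite !inE !eqxx ?orbT /=.
  have ab := edge_neq eab.
  move=> /orP[]/eqP b_ /orP[]/eqP a_; subst => //; rewrite ?eqxx // in ab *.
  by rewrite e_sym.
- have [D /andP[dD /eqP cD]] := max_dissociation_exists (del_edge e [set u; v]).
  by exists D => //; rewrite cD.
- by apply/imsetP; exists (u, v); rewrite ?inE.
- exact: leq_trans lt (dissociation_leq dD).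
Qed.

Lemma critical_edgeP f :
  f \in critical_edges e -> exists u v, f = [set u; v].
Proof. by rewrite inE => /andP[/imsetP[[u v] _ ->] _]; exists u, v. Qed.

Lemma witness_sub f D :
  dissociation_set (del_edge e f) D -> alpha3 e < #|D| -> f \subset D.
Proof.
move=> dD; rewrite ltnNge; apply: contraNT => fD.
exact/dissociation_leq/(dissociation_of_del fD).
Qed.

(* Comparing [S] and [D] branch by branch at [x], some branch must gain; replacing
   it in [S] breaks the constraint at most at the edge from [x] to that branch. *)
Lemma exchange S D x :
    max_dissociation_set e S -> x \in S ->
    dissociation_set e D -> x \notin D -> #|S| <= #|D| ->
  exists u, [/\ e x u, [set x; u] \in critical_edges e
              & #|S :&: branch e x u| < #|D :&: branch e x u|].
Proof.
move=> /andP[dS /eqP cS] xS dD xD SD.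
have lt : #|S :\ x| < #|D| by move: SD; rewrite (cardsD1 x S) xS.
have [r rx gain] := branch_heavy e_sym xD lt.
have big := swap_ltn gain; rewrite cS in big.
have [/exists_inP[u uB exu] | /exists_inPn no] :=
  boolP [exists u in branch e x r, e x u].
  rewrite -(branch_eq e_sym uB) in gain big *.
  exists u; split=> //; apply/criticalP; split=> //.
  exists (swap S D (branch e x u)) => //.
  by apply: swap_branch_del => //; exact: dissociation_del.
case: (negP (_ : ~~ (alpha3 e < #|swap S D (branch e x r)|))) => //.
rewrite -leqNgt; apply/dissociation_leq/swap_dissociation => // y z yB zB.
apply/negP => eyz; have zx := branch_exit e_sym rx yB zB eyz.
by move: (no _ yB); rewrite e_sym -zx eyz.
Qed.

(** Let [W] witness the critical edge. Putting [D] into [W] on the branch of [u] gives a set without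
    [u], so of size at most [alpha3 e]. Hence [W] beats [D] there, and putting [W] into [D] on that
    branch gains. Nothing else changes, so a second gain at [v] remains possible. *)
Lemma critical_gain u v D :
    [set v; u] \in critical_edges e -> dissociation_set e D ->
    u \notin D -> v \notin D ->
  exists D', [/\ dissociation_set e D', #|D| < #|D'|, v \notin D'
               & D' :\: branch e v u = D :\: branch e v u].
Proof.
move=> /criticalP[evu [W dW aW]] dD uD vD.
have uv : u != v by rewrite eq_sym edge_neq.
have vB := branch_center e_sym uv; have uB := branch_self e v u.
exists (swap D W (branch e v u)); rewrite swapD in_swap (negbTE vB); split=> //.
  apply: (@dissociation_of_del _ _ [set v; u]).
    by rewrite subUset !sub1set in_swap (negbTE vB) (negbTE vD).
  by apply: swap_branch_del => //; exact: dissociation_del.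
apply: swap_ltn.
have : #|swap W D (branch e v u)| <= alpha3 e.
  apply/dissociation_leq/(@dissociation_of_del _ _ [set v; u]).
    by rewrite subUset !sub1set !in_swap uB (negbTE uD) andbF.
  by apply: swap_branch_del => //; exact: dissociation_del.
by move=> /leq_ltn_trans/(_ aW); rewrite card_swap -(cardsID (branch e v u) W) ltn_add2r.
Qed.

Lemma critical_cover u v S :
    max_dissociation_set e S -> [set u; v] \in critical_edges e ->
  (u \in S) || (v \in S).
Proof.
move=> /andP[dS /eqP cS] uv; apply: contraT; rewrite negb_or => /andP[uS vS].
have [D [dD + _ _]] := critical_gain uv dS vS uS.
by rewrite cS ltnNge dissociation_leq.
Qed.

Lemma critical_edge u v : [set u; v] \in critical_edges e -> e u v.
Proof. by case/criticalP. Qed.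

(** If both [u] and [w] were in [S], [v] would have degree 2. If neither were, drop [v] and gain on
    the branches of [u] and [w] in turn: one vertex is paid and at least two are won. *)
Lemma critical_center u v w S :
    max_dissociation_set e S -> u != w ->
    [set v; u] \in critical_edges e -> [set v; w] \in critical_edges e ->
  v \in S -> (u \in S) = ~~ (w \in S).
Proof.
move=> mS uw cu cw vS; have [evu evw] := (critical_edge cu, critical_edge cw).
case/andP: (mS) => dS /eqP cS.
case: (boolP (u \in S)) (boolP (w \in S)) => uS [] wS //.
  by case/eqP: uw; apply: (dissociationP _ _ dS v).
have dS' : dissociation_set e (S :\ v) by apply: dissociation_sub dS; exact: subsetDl.
have [||D [dD lD vD DE]] := critical_gain cu dS'; rewrite ?inE ?eqxx ?(negbTE uS) ?andbF //.
have wD : w \notin D.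
  have wB : w \notin branch e v u.
    by apply: contraNN uw => wB; rewrite eq_sym (branch_edge evu wB).
  by move/setP: DE => /(_ w); rewrite !in_setD wB (negbTE wS) andbF /= => ->.
have [D' [dD' lD' _ _]] := critical_gain cw dD wD vD.
move: (dissociation_leq dD'); rewrite -cS (cardsD1 v S) vS leqNgt.
by rewrite (leq_ltn_trans lD lD').
Qed.

Lemma branch_disjoint u v : e u v -> [disjoint branch e u v & branch e v u].
Proof.
move=> euv; have uv := edge_neq euv; have evu : e v u by rewrite e_sym.
apply/pred0P => y /=; apply/negbTE/negP => /andP[+ yB].
rewrite inE => vy.
(* A walk from [v] avoiding [u] cannot enter [branch e v u], whose only exit is the edge [uv]. *)
have cl : closed (off e u) [pred y | y \notin branch e v u].
  apply: intro_closed; first exact: off_sym.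
  move=> a b /and3P[eab au bu] aB; apply: contraNN bu => bB.
  by apply/eqP; case: (branch_exit_edge evu bB aB); rewrite // e_sym.
have : (v \notin branch e v u) = (y \notin branch e v u) := closed_connect cl vy.
by rewrite yB branch_center.
Qed.

(* If both ends of a critical edge lie in [S], the witness [W] beats [S] on one side
   of the edge; the swap minus one end then allows an exchange within that side. *)
Lemma critical_adjacent u v S :
    max_dissociation_set e S -> [set u; v] \in critical_edges e ->
    u \in S -> v \in S ->
  exists2 g, g \in critical_edges e & (g != [set u; v]) && ~~ [disjoint [set u; v] & g].
Proof.
move=> mS /criticalP[euv [W dW aW]] uS vS.
have uvW := witness_sub dW aW.
have [dS cS] : dissociation_set e S /\ #|S| = alpha3 e by case/andP: mS => ? /eqP.
have evu : e v u by rewrite e_sym.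
have [vu uv] := (edge_neq evu, edge_neq euv).
have uB := branch_self e v u; have vB := branch_center e_sym uv.
(* Common ending: [D] agrees with [S] on the branch of [y], so [exchange] at [x] gains elsewhere,
   along a different critical edge. *)
have finish x y D : [set x; y] = [set u; v] -> x \in S -> e x y ->
    dissociation_set (del_edge e [set x; y]) D ->
    D :&: branch e x y = S :&: branch e x y -> #|S| < #|D| ->
  exists2 g, g \in critical_edges e & (g != [set u; v]) && ~~ [disjoint [set u; v] & g].
  move=> xyE xS exy dD DS SD.
  have [|||z [exz cz gain]] := exchange mS xS (D := D :\ x).
  - apply: (@dissociation_of_del _ _ [set x; y]).
      by rewrite subUset sub1set !inE eqxx.
    by apply: dissociation_sub dD; exact: subsetDl.
  - by rewrite !inE eqxx.
  - by move: SD; rewrite (cardsD1 x D); case: (x \in D) => //= /ltnW.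
  exists [set x; z] => //; rewrite -xyE; apply/andP; split; last first.
    by apply/pred0Pn; exists x; rewrite /= !inE eqxx.
  apply: contraTneq gain => /setP/(_ z); rewrite !inE eqxx orbT eq_sym.
  rewrite (negbTE (edge_neq exz)) /= => /esym/eqP ->.
  rewrite -leqNgt setIDAC DS; apply: subset_leq_card; exact: subsetDl.
have := aW; rewrite -cS -(cardsID (branch e v u) S) -(cardsID (branch e v u) W).
have dS' := dissociation_del [set v; u] dS.
have vuE : [set v; u] = [set u; v] by rewrite setUC.
rewrite -vuE in dW.
case: (ltnP #|S :\: branch e v u| #|W :\: branch e v u|) => [lt _|ge lt].
  apply: (finish v u (swap W S (branch e v u))) => //.
  - exact: swap_branch_del.
  - exact: swapI.
  - by rewrite card_swap -(cardsID (branch e v u) S) ltn_add2l.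
apply: (finish u v (swap S W (branch e v u))) => //.
- by rewrite -vuE; exact: swap_branch_del.
- apply/setP => y; rewrite !in_setI in_swap.
  case: (boolP (y \in branch e u v)) => yB; rewrite ?andbF //.
  by rewrite (disjointFr (branch_disjoint euv) yB).
- apply: swap_ltn; rewrite ltnNge; apply: contraTN lt => le.
  by rewrite -leqNgt leq_add.
Qed.
(** Dropping one end costs at most one vertex and destroys the only possible conflict. *)
Lemma witness_max u v W :
    dissociation_set (del_edge e [set u; v]) W -> alpha3 e < #|W| ->
  max_dissociation_set e (W :\ u).
Proof.
move=> dW aW.
have d : dissociation_set e (W :\ u).
  apply: (@dissociation_of_del _ _ [set u; v]).
    by rewrite subUset sub1set !inE eqxx.
  by apply: dissociation_sub dW; exact: subsetDl.
rewrite /max_dissociation_set d eqn_leq dissociation_leq //=.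
by move: aW; rewrite (cardsD1 u W); case: (u \in W) => //= /ltnW.
Qed.

(** If [W] witnesses [au], then [W :\ a] and [W :\ u] are both maximum. By [critical_center] at [u],
    [v] lies in [W]; at [v], it keeps [b] out of the first set and puts it in the second. So
    [b = a], which closes a triangle. *)
Lemma critical_no_P4 a u v b :
    [set a; u] \in critical_edges e -> [set u; v] \in critical_edges e ->
    [set v; b] \in critical_edges e -> a != v -> u != b -> False.
Proof.
move=> cau cuv cvb av ub.
have [[eau euv] evb] := (critical_edge cau, critical_edge cuv, critical_edge cvb).
have [_ [W dW aW]] := criticalP _ _ cau.
have /subsetP auW := witness_sub dW aW.
have aW' : a \in W by rewrite auW // !inE eqxx.
have uW : u \in W by rewrite auW // !inE eqxx orbT.
have m1 := witness_max dW aW.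
have m2 : max_dissociation_set e (W :\ u).
  by rewrite setUC in dW; exact: witness_max dW aW.
have ua : u != a by rewrite eq_sym edge_neq.
have cua : [set u; a] \in critical_edges e by rewrite setUC.
have cvu : [set v; u] \in critical_edges e by rewrite setUC.
have vu : v != u by rewrite eq_sym edge_neq.
have := critical_center m1 av cua cuv.
rewrite !inE eqxx /= ua uW [v == a]eq_sym av => /(_ isT)/esym/negbFE vW.
have := critical_center m1 ub cvu cvb; rewrite !inE ua uW [v == a]eq_sym av vW.
move=> /(_ isT)/esym; have := critical_center m2 ub cvu cvb.
rewrite !inE eqxx vu vW => /(_ isT)/esym/negbFE/andP[_ bW].
rewrite bW andbT negbK => /eqP bE; rewrite bE in evb.
apply: (e_acyclic (c := [:: a; u; v])) => //.
by rewrite /ucycle /= eau euv evb !inE negb_or edge_neq // av edge_neq.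
Qed.

Lemma critical_other f x :
  f \in critical_edges e -> x \in f -> exists y, f = [set x; y].
Proof.
move=> /critical_edgeP[u [v ->]]; rewrite !inE => /orP[]/eqP ->; first by exists v.
by exists u; rewrite setUC.
Qed.

(** If a maximum set avoids [x], [exchange] yields a critical edge at [x]; conversely, a witness of
    such an edge minus [x] is a maximum set. *)
Lemma notin_coreP S x :
    max_dissociation_set e S -> x \in S ->
  reflect (exists2 f, f \in critical_edges e & x \in f) (x \notin core e).
Proof.
move=> mS xS; apply: (iffP idP) => [|[f cf xf]].
  rewrite inE => /forallPn[D]; rewrite negb_imply => /andP[/andP[dD /eqP cD] xD].
  have [|u [_ cu _]] := exchange mS xS dD xD.
    by case/andP: mS => _ /eqP ->; rewrite cD.
  by exists [set x; u] => //; rewrite !inE eqxx.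
have [y fE] := critical_other cf xf; rewrite fE in cf.
have [_ [W dW aW]] := criticalP _ _ cf.
rewrite inE; apply/forallPn; exists (W :\ x).
by rewrite (witness_max dW aW) !inE eqxx.
Qed.

End Forest.

(** * Counting vertices outside the core against critical edges *)

Lemma leq_card_rel (A B : finType) (X : {set A}) (Y : {set B}) (R : A -> B -> bool) :
    (forall x, x \in X -> exists2 y, y \in Y & R x y) ->
    (forall x1 x2 y, x1 \in X -> x2 \in X -> y \in Y -> R x1 y -> R x2 y -> x1 = x2) ->
  #|X| <= #|Y|.
Proof.
move=> total inj; pose F x := [pick y in Y | R x y].
have FP x : x \in X -> exists2 y, F x = Some y & (y \in Y) && R x y.
  move=> /total[y yY Rxy]; rewrite /F; case: pickP => [z|/(_ y)]; first by exists z.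
  by rewrite /= yY Rxy.
have Finj : {in X &, injective F}.
  move=> x1 x2 x1X x2X; have [y1 -> /andP[y1Y R1]] := FP _ x1X.
  by have [y2 -> /andP[_ R2]] := FP _ x2X => -[y12]; apply: (inj _ _ y1); rewrite // y12.
have SomeI : injective (@Some B) by move=> ? ? [].
rewrite -(card_in_imset Finj) -(card_imset Y SomeI).
apply/subset_leq_card/subsetP => _ /imsetP[x xX ->].
by have [y -> /andP[yY _]] := FP _ xX; exact: imset_f.
Qed.

Section Count.

Variables (V : finType) (e : rel V).
Hypotheses (e_sym : symmetric e) (e_irr : irreflexive e) (e_acyclic : acyclic e).
Variable S : {set V}.
Hypothesis mS : max_dissociation_set e S.

Let only (x : V) (f : {set V}) := [forall g in critical_edges e, (x \in g) ==> (g == f)].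

(* Pairs each critical edge with one vertex of [S]: the middle vertex of a critical
   3-path is paired with the edge whose other end is outside [S]. *)
Let rep (x : V) (f : {set V}) := (x \in f) && ((S :&: f == [set x]) || only x f).

Lemma onlyPn x f :
  ~~ only x f -> exists2 y, [set x; y] \in critical_edges e & [set x; y] != f.
Proof.
case/forallPn => g; rewrite !negb_imply => /and3P[cg xg gf].
by have [y gE] := critical_other cg xg; exists y; rewrite -gE.
Qed.

Lemma setI_edge x y : x \in S -> (S :&: [set x; y] == [set x]) = (y \notin S) || (x == y).
Proof.
move=> xS; apply/eqP/orP => [/setP/(_ y)|[yS|/eqP <-]].
- by rewrite !inE eqxx orbT andbT eq_sym => ->; case: (x == y); [right | left].
- apply/setP => z; rewrite !inE; case: eqVneq => [->|_] /=; first by rewrite xS.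
  by case: eqVneq => [->|_]; rewrite ?andbF // andbT (negbTE yS).
- by rewrite setUid; apply/setIidPr; rewrite sub1set.
Qed.

Lemma critical_neq x y : [set x; y] \in critical_edges e -> x == y = false.
Proof. by move=> c; apply/negbTE/(edge_neq e_irr)/(critical_edge e_sym e_irr). Qed.

Lemma noncore_leq : #|S :\: core e| <= eta e.
Proof.
apply: (leq_card_rel (R := rep)) => [x|x1 x2 f].
  rewrite inE => /andP[xC xS].
  have /(notin_coreP e_sym e_irr e_acyclic mS xS)[f cf xf] := xC.
  have [y fE] := critical_other cf xf; subst f.
  have [o|/onlyPn[z cz zy]] := boolP (only x [set x; y]).
    by exists [set x; y]; rewrite // /rep o xf orbT.
  have yz : y != z by apply: contraNneq zy => ->.
  (* Exactly one of [y], [z] is outside [S]; the edge to it is paired with [x]. *)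
  have := critical_center e_sym e_irr e_acyclic mS yz cf cz xS.
  case: (boolP (z \in S)) => zS /= yS.
    by exists [set x; y]; rewrite // /rep xf setI_edge // yS.
  by exists [set x; z]; rewrite // /rep setI_edge // zS !inE eqxx.
rewrite !in_setD => /andP[_ x1S] /andP[_ x2S] cf /andP[x1f r1] /andP[x2f r2].
have [//|x12] := eqVneq x1 x2.
have x2I : x2 \in S :&: f by rewrite inE x2S.
have x1I : x1 \in S :&: f by rewrite inE x1S.
(* Both ends of [f] lie in [S], so each pairing comes from [only], which [critical_adjacent]
   refutes. *)
case/orP: r1 => [/eqP fE|o1]; first by move: x2I; rewrite fE inE => /eqP.
case/orP: r2 => [/eqP fE|o2]; first by move: x1I; rewrite fE inE => /eqP.
have [y fE] := critical_other cf x1f; subst f.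
move: x2f; rewrite !inE eq_sym (negbTE x12) => /eqP yE; subst y.
have [g cg /andP[gf]] := critical_adjacent e_sym e_irr e_acyclic mS cf x1S x2S.
case/pred0Pn => z /= /andP[+ zg]; rewrite !inE => /orP[]/eqP zE; subst z.
  by move/forall_inP: o1 => /(_ g cg); rewrite zg (negbTE gf).
by move/forall_inP: o2 => /(_ g cg); rewrite zg (negbTE gf).
Qed.

Lemma eta_leq : eta e <= #|S :\: core e|.
Proof.
apply: (leq_card_rel (R := fun f x => rep x f)) => [f cf|f1 f2 x].
  have pick x : x \in S -> rep x f -> exists2 y, y \in S :\: core e & rep y f.
    move=> xS r; exists x => //; rewrite inE xS andbT.
    by apply/(notin_coreP e_sym e_irr e_acyclic mS xS); exists f => //; case/andP: r.
  have [u [v fE]] := critical_edgeP cf; subst f.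
  have cvu : [set v; u] \in critical_edges e by rewrite setUC.
  case: (boolP (u \in S)) (boolP (v \in S)) => uS [] vS.
  - have [ou|/onlyPn[a ca av]] := boolP (only u [set u; v]).
      by apply: (pick u) => //; rewrite /rep ou orbT !inE eqxx.
    have [ov|/onlyPn[b cb bu]] := boolP (only v [set u; v]).
      by apply: (pick v) => //; rewrite /rep ov orbT !inE eqxx orbT.
    (* Both ends of [f] carry further critical edges, which is impossible. *)
    case: (critical_no_P4 e_sym e_irr e_acyclic (a := a) _ cf cb).
    + by rewrite setUC.
    + by apply: contraNneq av => ->.
    + by apply: contraNneq bu => <-; rewrite setUC.
  - by apply: (pick u) => //; rewrite /rep setI_edge // vS !inE eqxx.
  - by apply: (pick v) => //; rewrite /rep setUC setI_edge // uS !inE eqxx.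
  - have := critical_cover e_sym e_irr e_acyclic mS cf.
    by rewrite (negbTE uS) (negbTE vS).
move=> c1 c2; rewrite inE => /andP[_ xS] /andP[x1 r1] /andP[x2 r2].
(* A pairing from [only] makes the edges equal; otherwise both other ends lie outside [S], which
   [critical_center] forbids for distinct edges. *)
case/orP: r1 => [r1|/forall_inP/(_ _ c2)]; last by rewrite x2 => /eqP.
case/orP: r2 => [r2|/forall_inP/(_ _ c1)]; last by rewrite x1 => /eqP.
have [y fE] := critical_other c1 x1; have [z gE] := critical_other c2 x2; subst f1 f2.
have [<- //|yz] := eqVneq y z.
move: r1 r2; rewrite !setI_edge // !critical_neq // !orbF => yS zS.
have := critical_center e_sym e_irr e_acyclic mS yz c1 c2 xS.
by rewrite zS (negbTE yS).
Qed.

Lemma card_max_dissociation : #|S| = #|core e| + eta e.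
Proof.
have sub : core e \subset S.
  by apply/subsetP => x; rewrite inE => /forallP/(_ S); rewrite mS.
have -> : eta e = #|S :\: core e| by apply/eqP; rewrite eqn_leq eta_leq noncore_leq.
by rewrite -(cardsID (core e) S) (setIidPr sub).
Qed.

End Count.

(** * Insulated edges, critical 3-paths and the size formula in a tree *)

Theorem theorem3p7 (V : finType) (T : rel V) (treeT : tree T) :
  [/\ (forall (S f : {set V}), max_dissociation_set T S -> insulated T f ->
         #|S :&: f| = 1),
      (forall (S : {set V}) (u v w : V),
         max_dissociation_set T S -> critical_3path T u v w ->
         #|S :&: [set u; v; w]| = 2)
    & alpha3 T = #|core T| + eta T].
Proof.
case: treeT => -[T_sym T_irr] _ T_acyclic; split.
- move=> S f mS [cf ins]; have [u [v fE]] := critical_edgeP cf; subst f.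
  have cover := critical_cover T_sym T_irr T_acyclic mS cf.
  case: (boolP (u \in S)) (boolP (v \in S)) cover => uS [] vS // _.
  + have [g cg /andP[gf]] := critical_adjacent T_sym T_irr T_acyclic mS cf uS vS.
    by rewrite ins.
  + have /eqP -> : S :&: [set u; v] == [set u] by rewrite setI_edge // vS.
    exact: cards1.
  + have /eqP -> : S :&: [set u; v] == [set v] by rewrite setUC setI_edge // uS.
    exact: cards1.
- move=> S u v w mS [/= + cu cw]; rewrite !inE negb_or !andbT.
  move=> /andP[/andP[uv uw] vw].
  have cvu : [set v; u] \in critical_edges T by rewrite setUC.
  have h1 := critical_cover T_sym T_irr T_acyclic mS cu.
  have h2 := critical_cover T_sym T_irr T_acyclic mS cw.
  have h3 := critical_center T_sym T_irr T_acyclic mS uw cvu cw.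
  have two x y z : x \in S -> y \in S -> z \notin S -> x != y ->
      #|S :&: [set x; y; z]| = 2.
    move=> xS yS zS xy; rewrite setIUr (disjoint_setI0 (_ : [disjoint S & [set z]])).
      by rewrite setU0 (setIidPr _) ?cards2 ?xy // subUset !sub1set xS yS.
    by rewrite disjoint_sym disjoints1.
  (* With [v] in [S], exactly one of [u], [w] is too; without it, covering both edges forces [u] and
     [w]. *)
  case: (boolP (v \in S)) h1 h2 h3 => vS.
    move=> _ _ /(_ isT); case: (boolP (w \in S)) => wS /= uS.
      by rewrite -setUA setUC two // uS.
    exact: two.
  by rewrite orbF /= => uS wS _; rewrite setUAC two.
- have [S mS] := max_dissociation_exists T.
  by rewrite -(card_max_dissociation T_sym T_irr T_acyclic mS); case/andP: mS => _ /eqP.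
Qed.
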